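(* Let $\alpha=\alpha_0^{p^s}\in\mathcal{T}_2\setminus\{0\}$, where $\alpha_0\in\mathcal{T}_2$ is such that $x^n-\alpha_0$ is irreducible over $\mathcal{R}_2$. Let $\beta\in\mathcal{T}_2\setminus\{0\}$, and let $\mathcal{C}=\langle(x^n-\alpha_0)^\nu\rangle$ be an $(\alpha+\gamma\beta)$-constacyclic code of length $np^s$ over $\mathcal{R}_2$, where $0\le\nu\le2p^s$. Then the RT distance $d_{RT}(\mathcal{C})$ of the code $\mathcal{C}$ is given by $$d_{RT}(\mathcal{C})=\begin{cases}1&\text{if }0\le\nu\le p^s;\\ n\nu-np^s+1&\text{if }p^s+1\le\nu\le2p^s-1;\\0&\text{if }\nu=2p^s.\end{cases}$$
   Context: $\mathcal{R}_2$ is a finite commutative chain ring with unity, with maximal ideal $\langle\gamma\rangle$, where $\gamma\neq0$ and $\gamma^2=0$; its residue field has order $p^m$, $p$ prime. $\zeta\in\mathcal{R}_2$ has multiplicative order $p^m-1$ and $\mathcal{T}_2=\{0,1,\zeta,\dots,\zeta^{p^m-2}\}$. $n,s$ are positive integers with $\gcd(n,p)=1$. For a unit $\lambda$, $\lambda$-constacyclic codes of length $N$ over $\mathcal{R}_2$ are identified with ideals of $\mathcal{R}_2[x]/\langle x^N-\lambda\rangle$, whose elements are represented by polynomials of degree less than $N$. The Rosenbloom-Tsfasman (RT) weight is $w_{RT}(c(x))=1+\deg c(x)$ if $c(x)\ne0$ and $w_{RT}(0)=0$; the RT distance is $d_{RT}(\mathcal{C})=\min\{w_{RT}(c):c\in\mathcal{C}\setminus\{0\}\}$,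 with the convention $d_{RT}(\{0\})=0$. *)

(* Defs.v *)
From HB Require Import structures.
From mathcomp Require Import all_boot all_order all_algebra.

Set Implicit Arguments.
Unset Strict Implicit.
Unset Printing Implicit Defensive.

Import GRing.Theory.
Local Open Scope ring_scope.

(* [idealr_closed] describes proper ideals; leaving the unit ideal out of the
   comparison is harmless, since it contains every ideal. *)
Definition chain_ring (R : finComNzRingType) : Prop :=
  forall I J : {set R}, idealr_closed I -> idealr_closed J ->
    (I \subset J) || (J \subset I).

Definition maximal_ideal (R : finComNzRingType) (M : {set R}) : Prop :=
  idealr_closed M /\
  forall J : {set R}, idealr_closed J -> M \subset J -> J = M.

Definition principal_ideal (R : finComNzRingType) (g : R) : {set R} :=
  [set a * g | a : R].

(* The set of additive cosets of I, i.e. the underlying set of R / I. *)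
Definition residue_classes (R : finComNzRingType) (I : {set R}) :
    {set {set R}} :=
  equivalence_partition (fun x y : R => x - y \in I) [set: R].

Definition is_unit (A : comNzRingType) (a : A) : Prop := exists b, a * b = 1.

(* Irreducible elements of a commutative ring that may have zero divisors, in
   which case neither [irreducible_poly] nor the [unitRingType] structure of
   [{poly R}] is available. *)
Definition irreducible_elt (A : comNzRingType) (a : A) : Prop :=
  [/\ a <> 0, ~ is_unit a &
      forall b c : A, a = b * c -> is_unit b \/ is_unit c].

(* For z of multiplicative order k, this is {0, 1, z, ..., z ^+ (k - 1)}. *)
Definition teichmuller (R : finComNzRingType) (z : R) (k : nat) : {set R} :=
  0 |: [set z ^+ (i : nat) | i : 'I_k].

HB.instance Definition _ (R : finComNzRingType) (h : {poly R}) :=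
  Finite.on {poly %/ h}.

(* R[x] / <x^N - lambda>; its elements are the polynomials of degree < N.
   This is the intended ring only for 0 < N (see [mk_monic]). *)
Notation constacyclic_ring N lambda := {poly %/ 'X^N - (lambda)%:P}.

(* [size] is 1 + degree on nonzero polynomials, and 0 on the zero one. *)
Definition rt_weight (R : finComNzRingType) (h : {poly R})
    (c : {poly %/ h}) : nat :=
  size (c : {poly R}).

Definition rt_distance (R : finComNzRingType) (h : {poly R})
    (C : {set {poly %/ h}}) : nat :=
  if [pick c in C :\ 0] is Some c0
  then rt_weight [arg min_(c < c0 in C :\ 0) rt_weight c]
  else 0%N.

(* Main.v *)
Require Import Defs.
From HB Require Import structures.
From mathcomp Require Import all_boot all_order all_algebra all_fingroup cyclic.
From mathcomp Require Import zify ring.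

Set Implicit Arguments.
Unset Strict Implicit.
Unset Printing Implicit Defensive.

Import GRing.Theory Pdiv.Ring Pdiv.RingMonic.
Local Open Scope ring_scope.

(** Write f = X^n - alpha0, q = p^s, and let F be the class of f in the
    quotient ring by X^(nq) - (alpha + gamma beta). Everything rests on the
    fact that F^q = gamma u with u a unit ([exprXnsubC_eq_gamma_unit]).

    To see this, expand f^q: since p is prime, it equals X^(nq) - alpha0^q up
    to a multiple of p f ([exprB_prime_pow]), and p is a multiple of gamma
    because p is nilpotent in the ring ([residue_char]). As X^(nq) becomes
    alpha + gamma beta in the quotient, F^q = gamma (beta + F w) for some w.
    Hence F is nilpotent, and beta + F w, a unit plus a nilpotent, is a unit.

    If nu <= q, then the code contains gamma u, hence the nonzero constant
    gamma, of weight 1. If nu = q + k with k < q, the code is generated by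
    gamma F^k. Since gamma F^q = 0, the multiplier of gamma F^k may be reduced
    modulo f^(q-k), so that each codeword is the class of gamma r f^k with
    deg (r f^k) < nq: it is this very polynomial. As f^k is monic of degree
    nk, a nonzero codeword has degree at least nk, and gamma f^k attains this
    bound ([rt_distance_high_exponent]). Finally F^(2q) = gamma^2 u^2 = 0. *)

(** * Prime powers of a difference *)

(** Put d = x - y and expand x^p = (d + y)^p: each middle term contains both d
    and a binomial coefficient divisible by p. *)
Lemma subX_prime (A : comNzRingType) (p : nat) (x y : A) : prime p ->
  exists g, x ^+ p - y ^+ p = (x - y) ^+ p + p%:R * (x - y) * g.
Proof.
move=> p_pr; set d := x - y.
have -> : x = d + y by rewrite /d subrK.
case: p p_pr => [|k] // p_pr.
exists (\sum_(i < k) (d ^+ (k - i.+1) * y ^+ i.+1) *+ ('C(k.+1, i.+1) %/ k.+1)).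
rewrite exprDn big_ord_recr big_ord_recl /= subn0 subnn bin0 binn.
rewrite !expr0 mulr1 mul1r !mulr1n addrK; congr (_ + _).
rewrite mulr_sumr; apply: eq_bigr => i _; rewrite /bump /= add1n subSS.
have p_dvd : (k.+1 %| 'C(k.+1, i.+1))%N.
  by apply: prime_dvd_bin => //; exact: (ltn_ord i).
rewrite -{1}(divnK p_dvd) -{1}(subnSK (ltn_ord i)) exprS.
by rewrite mulrnA -!mulrA mulr_natl !mulrnAr.
Qed.

(** Keeping the factor x - y in the error term, and not only p, is what later
    makes the error nilpotent in the quotient ring. *)
Lemma exprB_prime_pow (A : comNzRingType) (p s : nat) (x y : A) : prime p ->
  exists g, (x - y) ^+ (p ^ s)
    = x ^+ (p ^ s) - y ^+ (p ^ s) + p%:R * (x - y) * g.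
Proof.
move=> p_pr; elim: s => [|s [g IH]].
  by exists 0; rewrite expn0 !expr1 mulr0 addr0.
rewrite expnSr !exprM.
move: (p ^ s)%N IH => q IH.
have [g1 Dp] := subX_prime (x ^+ q) (y ^+ q) p_pr.
have := subrXX ((x - y) ^+ q) (x ^+ q - y ^+ q) p.
set S := \sum_(i < p) _; set T := \sum_(i < q) x ^+ (q.-1 - i) * y ^+ i.
have -> : (x - y) ^+ q - (x ^+ q - y ^+ q) = p%:R * (x - y) * g.
  by rewrite IH addrC addKr.
move/(canRL (subrK _)) => ->.
exists (g * S - T * g1).
move: Dp => /(canLR (addrK _)) <-; rewrite [in p%:R * (x ^+ q - y ^+ q)]subrXX -/T.
by ring.
Qed.

(** * The residue characteristic *)

(** The residue classes are the cosets of the additive subgroup I, so this is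
    Lagrange's theorem applied to the class of 1. *)
Lemma natr_card_residue_classes (R : finComNzRingType) (I : {set R}) :
  zmod_closed I -> #|residue_classes I|%:R \in I.
Proof.
move=> [I0 IB].
have IN x : x \in I -> - x \in I by move=> Ix; rewrite -sub0r IB.
have ID x y : x \in I -> y \in I -> x + y \in I.
  by move=> Ix Iy; rewrite -[y]opprK IB // IN.
have gI : group_set I by apply/group_setP; split => // x y Ix Iy; exact: ID.
pose H := Group gI.
have -> : residue_classes I = rcosets H [set: R].
  rewrite /rcosets; apply: eq_imset => x; rewrite rcosetE; apply/setP => y.
  by rewrite !inE mem_rcoset /=; apply/idP/idP => /IN; rewrite opprB.
have nH : ([set: R] \subset 'N(H))%g.
  by apply: sub_abelian_norm; rewrite ?subsetT // ?FinRing.zmod_abelian.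
rewrite -[_%:R]FinRing.zmodXgE.
have := expg_cardG (mem_quotient H (in_setT (1 : R))).
rewrite card_quotient // -morphX ?(subsetP nH) // => /coset_idr; apply.
by rewrite (subsetP nH).
Qed.

Lemma principal_idealP (R : finComNzRingType) (g x : R) :
  reflect (exists a, x = a * g) (x \in principal_ideal g).
Proof.
by apply: (iffP imsetP) => [[a _ ->]|[a ->]]; exists a.
Qed.

(** Only properness needs an argument: 1 = a g would give 1 = a^k g^k = 0. *)
Lemma nilpotent_idealr_closed (R : finComNzRingType) (g : R) (k : nat) :
  g ^+ k = 0 -> idealr_closed (principal_ideal g).
Proof.
move=> gk; split.
- by apply/principal_idealP; exists 0; rewrite mul0r.
- apply/principal_idealP => -[a e].
  have := oner_neq0 R; rewrite -(expr1n R k) e exprMn gk mulr0.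
  by rewrite eqxx.
- move=> a u v /principal_idealP [b ->] /principal_idealP [c ->].
  by apply/principal_idealP; exists (a * b + c); rewrite mulrDl mulrA.
Qed.

(** The order p^m of the residue ring lies in (gamma), so p is nilpotent and
    generates a proper ideal. That ideal is comparable with (gamma), and by
    maximality it cannot be strictly larger. *)
Lemma residue_char (R : finComNzRingType) (gamma : R) (p m : nat) :
  chain_ring R -> maximal_ideal (principal_ideal gamma) -> gamma ^+ 2 = 0 ->
  #|residue_classes (principal_ideal gamma)| = (p ^ m)%N ->
  p%:R \in principal_ideal gamma.
Proof.
move=> chR [gI gmax] g2 card.
have /principal_idealP [t pm] : (p ^ m)%:R \in principal_ideal gamma.
  rewrite -card; apply: natr_card_residue_classes.
  by split; [case: gI | case: gI => _ _ IM x y Ix Iy; rewrite addrC -mulN1r IM].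
have pN : (p%:R : R) ^+ (m * 2) = 0.
  by rewrite exprM -natrX pm exprMn g2 mulr0.
have pI := nilpotent_idealr_closed pN.
have p_in : p%:R \in principal_ideal (p%:R : R).
  by apply/principal_idealP; exists 1; rewrite mul1r.
case/orP: (chR _ _ gI pI) => [le|/subsetP]; last exact.
by rewrite -(gmax _ pI le).
Qed.

(** * Units *)

(** u - c divides u^k - c^k = u^k, a unit. *)
Lemma is_unit_subr_nilpotent (A : comNzRingType) (u c : A) (k : nat) :
  is_unit u -> c ^+ k = 0 -> is_unit (u - c).
Proof.
move=> [v uv] ck; have := subrXX u c k; rewrite ck subr0 => e.
exists ((\sum_(i < k) u ^+ (k.-1 - i) * c ^+ i) * v ^+ k).
by rewrite mulrA -e -exprMn uv expr1n.
Qed.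

(** * Weights and quotients by a polynomial *)

Lemma rt_distance_eq (R : finComNzRingType) (h : {poly R})
    (C : {set {poly %/ h}}) (c0 : {poly %/ h}) :
  c0 \in C -> c0 != 0 ->
  (forall c, c \in C -> c != 0 -> (rt_weight c0 <= rt_weight c)%N) ->
  rt_distance C = rt_weight c0.
Proof.
move=> Cc0 nz0 min0; rewrite /rt_distance.
case: pickP => [c1 Cc1|/(_ c0)]; last by rewrite !inE nz0 Cc0.
case: arg_minnP => // c; rewrite !inE => /andP[nzc Cc] minc.
by apply/eqP; rewrite eqn_leq min0 // minc // !inE nz0.
Qed.

Lemma rt_distance_set0 (R : finComNzRingType) (h : {poly R}) :
  rt_distance [set (0 : {poly %/ h})] = 0%N.
Proof.
rewrite /rt_distance; case: pickP => // c.
by rewrite !inE andNb.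
Qed.

Lemma size_exp_monic (R : nzRingType) (f : {poly R}) (d k : nat) :
  f \is monic -> size f = d.+1 -> size (f ^+ k) = (d * k).+1.
Proof.
move=> fM sf; elim: k => [|k IH]; first by rewrite muln0 expr0 size_poly1.
rewrite exprS size_monicM ?monic_neq0 ?monic_exp //.
by rewrite IH sf addnS mulnS.
Qed.

Lemma in_qpolyC (R : nzRingType) (h : {poly R}) (a : R) :
  in_qpoly h a%:P = a%:P :> {poly R}.
Proof.
rewrite in_qpoly_small // (leq_ltn_trans (size_polyC_leq1 a)) //.
exact: size_mk_monic_gt1.
Qed.

Lemma in_qpoly_unit (R : comNzRingType) (h : {poly R}) (a : R) :
  is_unit a -> is_unit (in_qpoly h a%:P).
Proof.
move=> [b ab]; exists (in_qpoly h b%:P).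
by rewrite -rmorphM -polyCM ab rmorph1.
Qed.

(** * Distance of an ideal generated by a power of f *)

(** F^nu divides F^q = gamma u, so the ideal contains the constant gamma. *)
Lemma rt_distance_low_exponent (R : finComNzRingType) (h f : {poly R})
    (gamma : R) (u : {poly %/ h}) (q nu : nat) :
  gamma != 0 -> is_unit u ->
  in_qpoly h f ^+ q = in_qpoly h gamma%:P * u -> (nu <= q)%N ->
  rt_distance (principal_ideal (in_qpoly h (f ^+ nu))) = 1%N.
Proof.
move=> gamma0 [v uv] Fq le_nu.
have wt1 : rt_weight (in_qpoly h gamma%:P) = 1%N.
  by rewrite /rt_weight in_qpolyC size_polyC gamma0.
rewrite -wt1; apply: rt_distance_eq.
- apply/principal_idealP; exists (v * in_qpoly h f ^+ (q - nu)).
  rewrite rmorphXn -mulrA -exprD subnK // Fq.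
  by rewrite mulrC -mulrA uv mulr1.
- apply: contraTneq gamma0 => /(congr1 val) /=.
  by rewrite [rmodp _ _]in_qpolyC => /eqP; rewrite polyC_eq0 negbK.
- by move=> c _ c0; rewrite wt1 lt0n size_poly_eq0.
Qed.

(** gamma F^q = gamma^2 u = 0, so every element of the ideal has the form
    gamma r F^k with r of degree less than d (q - k). No reduction modulo h
    then takes place, and multiplication by the monic f^k adds dk to the
    degree. *)
Lemma rt_distance_high_exponent (R : finComNzRingType) (h f : {poly R})
    (gamma : R) (u : {poly %/ h}) (d q k : nat) :
  gamma != 0 -> gamma ^+ 2 = 0 -> is_unit u ->
  f \is monic -> size f = d.+1 -> size (mk_monic h) = (d * q).+1 ->
  in_qpoly h f ^+ q = in_qpoly h gamma%:P * u -> (0 < d)%N -> (k < q)%N ->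
  rt_distance (principal_ideal (in_qpoly h (f ^+ (q + k)))) = (d * k).+1.
Proof.
move=> gamma0 g2 [v uv] fM sf sh Fq d0 ltkq.
have fkM j : f ^+ j \is monic by rewrite monic_exp.
have sfk j := size_exp_monic j fM sf.
set F := in_qpoly h f in Fq *; set G := in_qpoly h gamma%:P in Fq *.
have Fqk : in_qpoly h (f ^+ (q + k)) = G * u * F ^+ k.
  by rewrite rmorphXn exprD Fq.
have GFq : G * F ^+ q = 0.
  by rewrite Fq mulrA -expr2 -rmorphXn -polyC_exp g2 !rmorph0 mul0r.
have small (r : {poly R}) : (size r <= d * (q - k))%N ->
  in_qpoly h (gamma%:P * r * f ^+ k) = gamma%:P * r * f ^+ k :> {poly R}.
  move=> sr; apply: in_qpoly_small.
  have [-> | nz] := eqVneq (gamma%:P * r) 0.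
    by rewrite mul0r size_poly0 sh.
  rewrite size_Mmonic // sfk addnS /= sh ltnS.
  rewrite -[in leqRHS](subnK (ltnW ltkq)) mulnDr leq_add2r.
  by rewrite mul_polyC (leq_trans (size_scale_leq _ _)).
have gfk : in_qpoly h (gamma%:P * f ^+ k) = gamma%:P * f ^+ k :> {poly R}.
  rewrite -[gamma%:P]mulr1 small // size_poly1 muln_gt0 d0 subn_gt0.
  exact: ltkq.
have szgfk : size (gamma%:P * f ^+ k) = (d * k).+1.
  by rewrite size_Mmonic ?polyC_eq0 // size_polyC gamma0 sfk.
rewrite -szgfk -gfk; apply: rt_distance_eq.
- apply/principal_idealP; exists v.
  by rewrite Fqk !mulrA [v * G]mulrC -(mulrA G v u) [v * u]mulrC uv mulr1
             rmorphM rmorphXn.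
- apply/eqP => /(congr1 val) /=; rewrite [rmodp _ _]gfk => e.
  by move: szgfk; rewrite e size_poly0.
move=> c /principal_idealP [a ->].
pose b : {poly R} := (a * u : {poly %/ h}).
have bE : a * u = in_qpoly h b.
  by apply: val_inj; symmetry; apply: in_qpoly_small; exact: size_mk_monic.
pose r := rmodp b (f ^+ (q - k)).
(* Division of b by f^(q-k): the quotient contributes a multiple of
   gamma F^q = 0. *)
have -> : a * in_qpoly h (f ^+ (q + k)) = in_qpoly h (gamma%:P * r * f ^+ k).
  rewrite Fqk !mulrA -(mulrA a) [G * u]mulrC mulrA bE.
  rewrite {1}(rdivp_eq (fkM (q - k)%N) b) -/r.
  rewrite rmorphD !rmorphM !rmorphXn -/F -/G !mulrDl.
  rewrite -!mulrA [F ^+ (q - k) * _]mulrCA -exprD subnK 1?ltnW // GFq mulr0.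
  by rewrite add0r mulrCA.
have sr : (size r <= d * (q - k))%N.
  by rewrite -ltnS -sfk ltn_rmodpN0 // monic_neq0.
rewrite -(inj_eq val_inj) /rt_weight gfk [val _]small // szgfk => nz.
rewrite small //.
have nzr : gamma%:P * r != 0 by apply: contraNneq nz => ->; rewrite mul0r.
rewrite size_Mmonic // sfk addnS /= -[ltnLHS]add0n ltn_add2r.
by rewrite size_poly_gt0.
Qed.

(** * The class of X^n - a modulo X^(n p^s) - (a^(p^s) + gamma beta) *)

(** With p = t gamma and f^(p^s) = X^(n p^s) - a^(p^s) + p f g, the unit is
    beta + t f g. *)
Lemma exprXnsubC_eq_gamma_unit (R : finComNzRingType)
    (gamma beta a : R) (p n s : nat) :
  prime p -> p%:R \in principal_ideal gamma -> gamma ^+ 2 = 0 ->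
  is_unit beta -> (0 < n)%N ->
  let h := 'X^(n * p ^ s) - (a ^+ (p ^ s) + gamma * beta)%:P in
  exists2 u : {poly %/ h}, is_unit u &
    in_qpoly h ('X^n - a%:P) ^+ (p ^ s) = in_qpoly h gamma%:P * u.
Proof.
move=> p_pr /principal_idealP [t pt] g2 beta_unit n0 h.
have q0 : (0 < p ^ s)%N by rewrite expn_gt0 prime_gt0.
have N0 : (0 < n * p ^ s)%N by rewrite muln_gt0 n0.
set f := 'X^n - a%:P; set F := in_qpoly h f; set G := in_qpoly h gamma%:P.
have [g fq] := @exprB_prime_pow {poly R} p s 'X^n a%:P p_pr.
have hh : mk_monic h = h.
  by rewrite /mk_monic monicXnsubC // size_XnsubC // ltnS N0.
have h0 : in_qpoly h h = 0.
  by apply: val_inj; rewrite /= hh rmodpp // monicXnsubC.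
pose w := in_qpoly h (t%:P * g).
have FqE : F ^+ (p ^ s) = G * (in_qpoly h beta%:P + F * w).
  rewrite -rmorphXn fq /F /G /w -!rmorphM -rmorphD -rmorphM.
  rewrite -[RHS]add0r -h0 -rmorphD; congr (in_qpoly h _).
  rewrite -(polyC_natr _ p) pt /h /f exprM !polyCD !polyCM polyC_exp.
  by ring.
exists (in_qpoly h beta%:P + F * w) => //.
(* F is nilpotent because F^(p^s) is a multiple of gamma. *)
rewrite -[F * w]opprK; apply: (@is_unit_subr_nilpotent _ _ _ (p ^ s * 2)).
  exact: in_qpoly_unit.
rewrite -mulrN exprMn exprM FqE exprMn -rmorphXn -polyC_exp g2.
by rewrite !rmorph0 !mul0r.
Qed.

Lemma teichmuller_unit (R : finComNzRingType) (z x : R) (k : nat) :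
  k.-primitive_root z -> x \in teichmuller z k :\ 0 -> is_unit x.
Proof.
move=> zk; rewrite !inE => /andP [/negPf -> /imsetP [i _ ->]].
exists (z ^+ (k - i)); rewrite -exprD subnKC ?prim_expr_order //.
exact: ltnW.
Qed.

Theorem theorem3p3 (R : finComNzRingType) (gamma zeta : R) (p m n s : nat)
    (alpha alpha0 beta : R) (nu : nat) :
  prime p ->
  chain_ring R ->
  maximal_ideal (principal_ideal gamma) ->
  gamma <> 0 ->
  gamma ^+ 2 = 0 ->
  #|residue_classes (principal_ideal gamma)| = (p ^ m)%N ->
  ((p ^ m).-1)%N.-primitive_root zeta ->
  (0 < n)%N ->
  (0 < s)%N ->
  coprime n p ->
  alpha \in teichmuller zeta (p ^ m).-1 :\ 0 ->
  alpha0 \in teichmuller zeta (p ^ m).-1 ->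
  alpha = alpha0 ^+ (p ^ s) ->
  irreducible_elt ('X^n - alpha0%:P : {poly R}) ->
  beta \in teichmuller zeta (p ^ m).-1 :\ 0 ->
  (nu <= 2 * p ^ s)%N ->
  let C : {set constacyclic_ring (n * p ^ s) (alpha + gamma * beta)} :=
    principal_ideal (in_qpoly _ (('X^n - alpha0%:P) ^+ nu)) in
  rt_distance C =
    if (nu <= p ^ s)%N then 1%N
    else if (p ^ s + 1 <= nu <= 2 * p ^ s - 1)%N
    then (n * nu - n * p ^ s + 1)%N
    else 0%N.
Proof.
move=> p_pr chR gmax /eqP gamma0 g2 card zeta_prim n0 _ _ _ _ -> _ beta_T.
move=> le_nu C.
have p_gamma := residue_char chR gmax g2 card.
have beta_unit := teichmuller_unit zeta_prim beta_T.
have [u u_unit Fq] :=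
  exprXnsubC_eq_gamma_unit alpha0 s p_pr p_gamma g2 beta_unit n0.
have q0 : (0 < p ^ s)%N by rewrite expn_gt0 prime_gt0.
rewrite {}/C; case: leqP => [le_nu_q|lt_q_nu].
  exact: rt_distance_low_exponent Fq le_nu_q.
rewrite addn1 lt_q_nu /=; case: leqP => [lt_nu|ge_nu].
  have -> : nu = (p ^ s + (nu - p ^ s))%N by rewrite subnKC // ltnW.
  have N0 : (0 < n * p ^ s)%N by rewrite muln_gt0 n0.
  rewrite (rt_distance_high_exponent (d := n) gamma0 g2 u_unit _ _ _ Fq) //.
  - by rewrite mulnDr addKn addn1.
  - exact: monicXnsubC.
  - exact: size_XnsubC.
  - by rewrite /mk_monic size_XnsubC // ltnS N0 monicXnsubC //= size_XnsubC.
  - by lia.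
(* Only nu = 2 p^s is left, where the code is zero. *)
have -> : nu = (p ^ s * 2)%N by lia.
rewrite rmorphXn [_ ^+ (p ^ s * 2)]exprM Fq exprMn -rmorphXn -polyC_exp g2.
rewrite !rmorph0 mul0r.
rewrite (_ : principal_ideal 0 = [set 0]) ?rt_distance_set0 //.
apply/setP => c; rewrite inE; apply/principal_idealP/eqP => [[a ->]|->].
  exact: mulr0.
by exists 0; rewrite mulr0.
Qed.
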